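(* Let $n,d\ge 1$ be integers and let $P$ be any position in $[n]^d$. There cannot be two distinct maximal positions $M_1\subset M_2$ such that both $M_1$ and $M_2$ can be reached by build-up from $P$. Similarly, there cannot be two distinct minimal positions $M_1\subset M_2$ such that both $M_1$ and $M_2$ can be reached by dismantling from $P$.
   Context: $[n]^d$ denotes the graph whose vertices (also called cubes) are the $d$-tuples $(x_1,\dots,x_d)$ with $x_i\in\{1,\dots,n\}$; two vertices are neighbours if they differ in exactly one coordinate, and in that coordinate by exactly $1$. A position is any subset of the vertices of $[n]^d$; its vertices are called black and the remaining vertices of $[n]^d$ are called white. A dismantling move removes from the current position a black vertex having exactly $d$ black neighbours in the current position. A build-up move adds to the current position a white vertex having exactly $d$ black neighbours in the current position. A position $Q$ can be reached from $P$ by dismantling (respectively build-up) if it is obtained from $P$ by a finite (possibly empty) sequence of dismantling (respectively build-up) moves. A position is minimal if no black vertex has exactly $d$ black neighbours (no dismantling move is possible), and maximal if no white vertex has exactly $d$ black neighbours (no build-up move is possible). *)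

(* Defs.v *)
From mathcomp Require Import all_boot.

Set Implicit Arguments.
Unset Strict Implicit.
Unset Printing Implicit Defensive.

(* Coordinates range over {0, ..., n-1} = 'I_n instead of {1, ..., n}. *)
Definition cube (n d : nat) : finType := {ffun 'I_d -> 'I_n}.

Section Positions.

Variables n d : nat.
Implicit Types (x y v : cube n d) (P Q : {set cube n d}).

Definition adjacent : rel (cube n d) := fun x y =>
  [exists i : 'I_d,
     ((x i == (y i).+1 :> nat) || (y i == (x i).+1 :> nat))
     && [forall j : 'I_d, (j != i) ==> (x j == y j)]].

(* A position is the set of its black vertices. *)
Definition black_neighbours P v : {set cube n d} :=
  [set w in P | adjacent v w].

Definition dismantling_move : rel {set cube n d} := fun P Q =>
  [exists v in P, (#|black_neighbours P v| == d) && (Q == P :\ v)].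

Definition buildup_move : rel {set cube n d} := fun P Q =>
  [exists v in ~: P, (#|black_neighbours P v| == d) && (Q == v |: P)].

Definition reached_by_dismantling P Q : bool := connect dismantling_move P Q.

Definition reached_by_buildup P Q : bool := connect buildup_move P Q.

Definition minimal_position P : bool :=
  [forall v in P, #|black_neighbours P v| != d].

Definition maximal_position P : bool :=
  [forall v in ~: P, #|black_neighbours P v| != d].

End Positions.

(* Main.v *)
Require Import Defs.
From mathcomp Require Import all_boot.
From mathcomp Require Import all_order ssralg ssrnum ssrint zify.

Set Implicit Arguments.
Unset Strict Implicit.
Unset Printing Implicit Defensive.

(** Let the surface of a position be 2d times the number of its cubes minus
    twice the number of its adjacent pairs. Adding a cube with k black
    neighbours changes the surface by 2(d - k), so all moves preserve it, and
    two positions reached from the same one have the same surface.  If M1 is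
    maximal and properly contained in M2, replay on top of M1 the build-up from
    P to M2: each new cube now has at least d black neighbours, and the first
    one has more than d since M1 is maximal. Hence M2 has a strictly smaller
    surface than M1. Dually, if M2 is minimal, replay inside M2 the dismantling
    from P to M1: each removed cube has at most d black neighbours, and the
    first one has fewer than d. *)

Section Surface.

Variables n d : nat.
Implicit Types (x y v : cube n d) (P Q M : {set cube n d}).

Lemma adjacent_sym : symmetric (@adjacent n d).
Proof.
move=> x y; apply: eq_existsb => i; rewrite orbC; congr (_ && _).
by apply: eq_forallb => j; rewrite (eq_sym (x j)).
Qed.

Lemma adjacent_irr : irreflexive (@adjacent n d).
Proof.
by move=> x; apply/negbTE/existsPn => i; rewrite orbb ltn_eqF.
Qed.

Lemma subset_black_neighbours P Q v :
  P \subset Q -> black_neighbours P v \subset black_neighbours Q v.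
Proof.
by move=> sPQ; apply/subsetP => w; rewrite !inE => /andP[/(subsetP sPQ)-> ->].
Qed.

Lemma black_neighboursU1 P v :
  black_neighbours (v |: P) v = black_neighbours P v.
Proof.
by apply/setP => w; rewrite !inE; case: eqP => // ->; rewrite adjacent_irr !andbF.
Qed.

Lemma card_black_neighboursU1 P v x : v \notin P ->
  #|black_neighbours (v |: P) x| = #|black_neighbours P x| + adjacent x v.
Proof.
move=> vP; rewrite addnC; case vx: (adjacent x v).
  have -> : black_neighbours (v |: P) x = v |: black_neighbours P x.
    by apply/setP => w; rewrite !inE; case: eqP => // ->; rewrite vx.
  by rewrite cardsU1 !inE (negbTE vP).
congr #|pred_of_set _|; apply/setP => w; rewrite !inE.
by case: eqP => // ->; rewrite vx !andbF.
Qed.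

(** The degree sum counts every adjacent pair twice. Taking values in [int] keeps the subtraction
    exact without a bound on degrees. *)
Definition surface P : int :=
  (Posz (d.*2 * #|P|) - Posz (\sum_(v in P) #|black_neighbours P v|))%R.

(** If [v] has k black neighbours, it adds k to the degree sum itself and 1 through each of these
    neighbours, hence 2k. *)
Lemma surfaceU1 P v : v \notin P ->
  surface (v |: P) =
  (surface P + Posz d.*2 - Posz (#|black_neighbours P v|.*2))%R.
Proof.
move=> vP; rewrite /surface cardsU1 vP big_setU1 //= black_neighboursU1.
under eq_bigr => x _ do rewrite card_black_neighboursU1 //.
rewrite big_split /=.
have -> : \sum_(x in P) adjacent x v = #|black_neighbours P v|.
  rewrite -sum1_card [RHS](eq_bigl (fun x => (x \in P) && adjacent x v)).
    by rewrite big_mkcondr; apply: eq_bigr => x _; case: ifP.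
  by move=> x; rewrite !inE adjacent_sym.
by rewrite mulnDr muln1; set s := bigop _ _ _; set c := #|_|; lia.
Qed.

Lemma surfaceD1 P v : v \in P ->
  surface P =
  (surface (P :\ v) + Posz d.*2 - Posz (#|black_neighbours P v|.*2))%R.
Proof.
move=> vP; rewrite -{1}(setD1K vP) surfaceU1 ?setD11 //.
by rewrite -black_neighboursU1 setD1K.
Qed.

(** Either the added cube is already in [M], or it sees at least its d neighbours from [P], so
    adding it cannot raise the surface. *)
Lemma surface_buildupU M P Q :
  buildup_move P Q -> (surface (M :|: Q) <= surface (M :|: P))%R.
Proof.
case/exists_inP => v _ /andP[/eqP dv /eqP ->]; rewrite setUCA.
case: (boolP (v \in M :|: P)) => [vMP|/surfaceU1 ->].
  by rewrite (setUidPr _) ?sub1set.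
have := subset_leq_card (subset_black_neighbours v (subsetUr M P)).
by rewrite dv; lia.
Qed.

(** Intersecting with [M] can only lose neighbours: a removed cube lying in [M] has at most d of
    them left. *)
Lemma surface_dismantlingI M P Q :
  dismantling_move P Q -> (surface (M :&: Q) <= surface (M :&: P))%R.
Proof.
case/exists_inP => v _ /andP[/eqP dv /eqP ->]; rewrite setIDA.
case: (boolP (v \in M :&: P)) => [/surfaceD1 ->|vMP].
  have := subset_leq_card (subset_black_neighbours v (subsetIr M P)).
  by rewrite dv; lia.
suff -> : (M :&: P) :\ v = M :&: P by [].
by apply/setDidPl; rewrite disjoint_sym disjoints1.
Qed.

Lemma reached_by_buildup_surface P Q :
  reached_by_buildup P Q -> P \subset Q /\ surface Q = surface P.
Proof.
case/connectP => p; elim: p P => [|R p IHp] P /=; first by move=> _ ->.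
case/andP => /exists_inP[v vP /andP[/eqP dv /eqP defR]] /IHp{}IHp /IHp[sRQ ->].
split; first by apply: subset_trans sRQ; rewrite defR subsetUr.
by rewrite defR surfaceU1 ?dv -?in_setC //; lia.
Qed.

Lemma reached_by_dismantling_surface P Q :
  reached_by_dismantling P Q -> Q \subset P /\ surface Q = surface P.
Proof.
case/connectP => p; elim: p P => [|R p IHp] P /=; first by move=> _ ->.
case/andP => /exists_inP[v vP /andP[/eqP dv /eqP defR]] /IHp{}IHp /IHp[sQR ->].
split; first by apply: subset_trans sQR _; rewrite defR subD1set.
by rewrite (surfaceD1 vP) dv defR; lia.
Qed.

Lemma reached_by_buildup_surfaceU M P Q :
  reached_by_buildup P Q -> (surface (M :|: Q) <= surface (M :|: P))%R.
Proof.
case/connectP => p; elim: p P => [|R p IHp] P /=; first by move=> _ ->.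
by case/andP => /(surface_buildupU M) leRP /IHp{}IHp /IHp; lia.
Qed.

Lemma reached_by_dismantling_surfaceI M P Q :
  reached_by_dismantling P Q -> (surface (M :&: Q) <= surface (M :&: P))%R.
Proof.
case/connectP => p; elim: p P => [|R p IHp] P /=; first by move=> _ ->.
by case/andP => /(surface_dismantlingI M) leRP /IHp{}IHp /IHp; lia.
Qed.

(** Follow the path while it stays inside [M]. The first cube leaving [M] has at least d neighbours
    in [M], and not exactly d by maximality, so the surface drops strictly; the later moves cannot
    raise it again. *)
Lemma maximal_position_buildup M P Q :
    maximal_position M -> P \subset M -> reached_by_buildup P Q ->
  Q \subset M \/ (surface (M :|: Q) < surface M)%R.
Proof.
move=> maxM sPM /connectP[p].
elim: p P sPM => [|R p IHp] P sPM /=; first by move=> _ ->; left.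
case/andP => /exists_inP[v _ /andP[/eqP dv /eqP defR]] pathR defQ.
case: (boolP (v \in M)) => vM.
  by apply: (IHp R) => //; rewrite defR subUset sub1set vM.
have {pathR defQ} /(reached_by_buildup_surfaceU M) : reached_by_buildup R Q.
  by apply/connectP; exists p.
move=> leR; right; move: (forall_inP maxM v) leR; rewrite inE vM => /(_ isT).
have := subset_leq_card (subset_black_neighbours v sPM).
have -> : M :|: R = v |: M by rewrite defR setUCA (setUidPl sPM).
by rewrite dv surfaceU1 //; lia.
Qed.

Lemma minimal_position_dismantling M P Q :
    minimal_position M -> M \subset P -> reached_by_dismantling P Q ->
  M \subset Q \/ (surface (M :&: Q) < surface M)%R.
Proof.
move=> minM sMP /connectP[p].
elim: p P sMP => [|R p IHp] P sMP /=; first by move=> _ ->; left.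
case/andP => /exists_inP[v _ /andP[/eqP dv /eqP defR]] pathR defQ.
(* Removing a cube outside [M] keeps [M] inside the position, so the induction continues; the strict
   drop comes from the first removed cube of [M]. *)
case: (boolP (v \in M)) => vM; last first.
  by apply: (IHp R) => //; rewrite defR subsetD1 sMP.
have {pathR defQ} /(reached_by_dismantling_surfaceI M) :
    reached_by_dismantling R Q.
  by apply/connectP; exists p.
move=> leR; right; move: (forall_inP minM v vM) leR.
have := subset_leq_card (subset_black_neighbours v sMP).
have -> : M :&: R = M :\ v by rewrite defR setIDA (setIidPl sMP).
by rewrite dv (surfaceD1 vM); lia.
Qed.

End Surface.

Theorem theorem1 (n d : nat) (hn : 1 <= n) (hd : 1 <= d)
    (P : {set cube n d}) :
  (~ exists M1 M2 : {set cube n d},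
       [/\ M1 <> M2, M1 \subset M2,
           maximal_position M1 /\ maximal_position M2,
           reached_by_buildup P M1 & reached_by_buildup P M2])
  /\
  (~ exists M1 M2 : {set cube n d},
       [/\ M1 <> M2, M1 \subset M2,
           minimal_position M1 /\ minimal_position M2,
           reached_by_dismantling P M1 & reached_by_dismantling P M2]).
Proof.
split=> -[M1 [M2 [neqM sM12 [m1 m2] PM1 PM2]]].
  have [sPM1 eqM1] := reached_by_buildup_surface PM1.
  have [_ eqM2] := reached_by_buildup_surface PM2.
  case: (maximal_position_buildup m1 sPM1 PM2) => [sM21|].
    by apply: neqM; apply/eqP; rewrite eqEsubset sM12.
  by rewrite (setUidPr sM12) eqM1 eqM2; lia.
have [_ eqM1] := reached_by_dismantling_surface PM1.
have [sM2P eqM2] := reached_by_dismantling_surface PM2.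
(* The roles are swapped here: the path to the smaller [M1] is replayed inside the larger [M2]. *)
case: (minimal_position_dismantling m2 sM2P PM1) => [sM21|].
  by apply: neqM; apply/eqP; rewrite eqEsubset sM12.
by rewrite (setIidPr sM12) eqM1 eqM2; lia.
Qed.
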